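(* Let $(G,X,x_0)$ be a $0$-dimensional ambit which possesses a left-continuous semigroup operation $*$ on $X$ extending the action of $G$, in the sense that $(gx_0)*x=gx$ for all $g\in G$ and $x\in X$. (Equivalently, $(G,X,x_0)\cong (G,S(\mathcal{A}),p_e)$ as ambits for some d-closed Boolean $G$-algebra $\mathcal{A}$ of subsets of $G$.) Then the properties EDRP, DRP and WDRP of $(G,X,x_0)$ are equivalent: $\mathrm{EDRP}\Leftrightarrow \mathrm{DRP}\Leftrightarrow \mathrm{WDRP}$.
   Context: Compact spaces are Hausdorff. A flow $(G,X)$ is a topological group $G$ acting continuously on a compact space $X$. An ambit $(G,X,x_0)$ is a flow with a distinguished point $x_0\in X$ whose orbit $Gx_0$ is dense in $X$; it is $0$-dimensional if $X$ is $0$-dimensional (has a basis of clopen sets). An isomorphism of ambits is a $G$-equivariant homeomorphism preserving distinguished points. Left-continuous means that $x\mapsto x*y$ is continuous for every fixed $y\in X$. A Boolean $G$-algebra of subsets of $G$ is a Boolean algebra of subsets of $G$ closed under left translations by elements of $G$. $S(\mathcal{A})$ is its Stone space of ultrafilters, on which $G$ acts by left translations, and $p_e=\{A\in\mathcal{A}: e\in A\}$. For $p\in S(\mathcal{A})$ and $A\in\mathcal{A}$ put $d_p(A)=\{g\in G: g^{-1}A\in p\}$. $\mathcal{A}$ is d-closed if $d_p[\mathcal{A}]\subseteq\mathcal{A}$ for every $p\in S(\mathcal{A})$. A coloring is a function $c\colon G\to 2^n$, $n\ge 1$. For $S\subseteq X$, $c$ is $S$-definable if there are clopen sets $U_0,\dots,U_{n-1}\subseteq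 X$ and points $y_0,\dots,y_{n-1}\in S$ such that for all $g\in G$, $i<n$: $c(g)(i)=1$ if $y_i\in gU_i$ and $c(g)(i)=0$ if $y_i\notin gU_i$. The ambit has $S$-DRP if for every $S$-definable coloring $c\colon G\to 2^n$, every $k\ge 1$ and every $k$-element $A\subseteq G$ there is $h\in G$ such that $|c[hA]|=1$. WDRP, DRP, EDRP mean $S$-DRP for $S=\{x_0\}$, $S=Gx_0$, $S=X$, respectively. *)

(* Defs.v *)
From HB Require Import structures.
From mathcomp Require Import all_boot.
From mathcomp Require Import boolp classical_sets functions cardinality topology.

Set Implicit Arguments.
Unset Strict Implicit.
Unset Printing Implicit Defensive.

Local Open Scope classical_set_scope.
Local Open Scope group_scope.

HB.structure Definition PreTopologicalGroup := {G of Topological G & Group G}.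

HB.mixin Record isTopologicalGroup G of PreTopologicalGroup G := {
  mulg_continuous : continuous (fun gh : G * G => gh.1 * gh.2);
  invg_continuous : continuous (fun g : G => g^-1)
}.

#[short(type="topologicalGroupType")]
HB.structure Definition TopologicalGroup :=
  {G of PreTopologicalGroup G & isTopologicalGroup G}.

Section Ambits.
Context {G : topologicalGroupType} {X : topologicalType}.
Implicit Types (act : G -> X -> X) (x : X).

Definition is_action act :=
  (forall x, act 1 x = x) /\ (forall g h x, act (g * h) x = act g (act h x)).

Definition is_flow act :=
  [/\ compact [set: X], hausdorff_space X, is_action act
    & continuous (fun gx : G * X => act gx.1 gx.2)].

Definition is_ambit act x0 := is_flow act /\ dense (range (act^~ x0)).

Definition left_continuous_semigroup_ext act x0 (op : X -> X -> X) :=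
  [/\ associative op, forall y, continuous (op^~ y)
    & forall g x, op (act g x0) x = act g x].

(* A coloring is a map into 2^n = {ffun 'I_n -> bool}. *)
Definition definable act (S : set X) n (c : G -> {ffun 'I_n -> bool}) :=
  exists (U : 'I_n -> set X) (y : 'I_n -> X),
    (forall i, clopen (U i) /\ S (y i)) /\
    (forall g i, c g i <-> (act g @` U i) (y i)).

Definition has_DRP_for act (S : set X) :=
  forall n (c : G -> {ffun 'I_n -> bool}), (0 < n)%N -> definable act S c ->
  forall k (A : set G), (0 < k)%N -> (A #= `I_k)%card ->
  exists h : G, (c @` [set h * a | a in A] #= `I_1)%card.

Definition WDRP act x0 := has_DRP_for act [set x0].
Definition DRP act x0 := has_DRP_for act (range (act^~ x0)).
Definition EDRP act := has_DRP_for act [set: X].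

End Ambits.

(* Existence of a basis of clopen sets; [separation_axioms.zero_dimensional]
   only asks that points be separated by clopen sets. *)
Definition clopen_based (X : topologicalType) :=
  exists B : set (set X), basis B /\ B `<=` clopen.

Definition ambit_isomorphic (G : topologicalGroupType) (X Y : topologicalType)
    (actX : G -> X -> X) (x0 : X) (actY : G -> Y -> Y) (y0 : Y) :=
  exists (f : X -> Y) (f' : Y -> X),
    [/\ cancel f f' /\ cancel f' f, continuous f, continuous f',
        forall g x, f (actX g x) = actY g (f x) & f x0 = y0].

Section StoneSpace.
Context {G : groupType}.

Definition ltranslate (g : G) (B : set G) := [set g * b | b in B].

Record galgebra := GAlgebra {
  galgebra_mem :> set G -> Prop;
  galgebra0 : galgebra_mem set0;
  galgebraC : forall B, galgebra_mem B -> galgebra_mem (~` B);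
  galgebraU : forall B C, galgebra_mem B -> galgebra_mem C ->
    galgebra_mem (B `|` C);
  galgebra_translate : forall g B, galgebra_mem B ->
    galgebra_mem (ltranslate g B)
}.

Record stone (A : galgebra) := Stone {
  stone_mem :> set G -> Prop;
  stone_sub : forall B, stone_mem B -> A B;
  stone_proper : ~ stone_mem set0;
  stoneI : forall B C, stone_mem B -> stone_mem C -> stone_mem (B `&` C);
  stone_up : forall B C, stone_mem B -> A C -> B `<=` C -> stone_mem C;
  stone_ultra : forall B, A B -> stone_mem B \/ stone_mem (~` B)
}.

Lemma galgebraT (A : galgebra) : A setT.
Proof. by rewrite -setC0; apply: galgebraC; apply: galgebra0. Qed.

Lemma galgebraI (A : galgebra) B C : A B -> A C -> A (B `&` C).
Proof.
move=> aB aC; rewrite -[_ `&` _]setCK setCI.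
by apply: galgebraC; apply: galgebraU; apply: galgebraC.
Qed.

Lemma stoneT (A : galgebra) (p : stone A) : p setT.
Proof.
by case: (stone_ultra p (galgebraT A)) => //; rewrite setCT => /stone_proper.
Qed.

Lemma ltranslateK g : cancel (ltranslate g) (ltranslate g^-1).
Proof.
move=> B; rewrite /ltranslate image_comp; apply/seteqP; split=> x /=.
  by case=> b Bb <-; rewrite mulKg.
by move=> Bx; exists x => //; rewrite mulKg.
Qed.

Lemma ltranslateKV g : cancel (ltranslate g^-1) (ltranslate g).
Proof. by move=> B; rewrite -{1}[g]invgK ltranslateK. Qed.

Lemma ltranslateE g B x : ltranslate g B x <-> B (g^-1 * x).
Proof.
split; first by case=> b Bb <-; rewrite mulKg.
by move=> Bx; exists (g^-1 * x) => //; rewrite mulVKg.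
Qed.

HB.instance Definition _ A := gen_eqMixin (stone A).
HB.instance Definition _ A := gen_choiceMixin (stone A).

Section Topology.
Variable A : galgebra.

Let base (B : set G) : set (stone A) := [set p | p B].

Let base_cover : \bigcup_(B in [set B | A B]) base B = setT.
Proof.
by apply/seteqP; split=> // p _; exists setT; [exact: galgebraT | exact: stoneT].
Qed.

Let base_join B C p : [set B | A B] B -> [set B | A B] C ->
  base B p -> base C p ->
  exists D, [/\ [set B | A B] D, base D p & base D `<=` base B `&` base C].
Proof.
move=> /= aB aC pB pC; exists (B `&` C); split.
- exact: galgebraI.
- exact: stoneI.
- by move=> q qBC; split; apply: stone_up qBC _ _ => // x [].
Qed.

HB.instance Definition _ :=
  isBaseTopological.Build (stone A) base_cover base_join.

End Topology.

Section Action.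
Variable A : galgebra.

Section ActionDef.
Variables (g : G) (p : stone A).
Let gp : set G -> Prop := [set ltranslate g B | B in [set B | p B]].

Let gpE B : gp B <-> p (ltranslate g^-1 B).
Proof.
split; first by case=> C pC <-; rewrite ltranslateK.
by move=> pB; exists (ltranslate g^-1 B) => //; rewrite ltranslateKV.
Qed.

Let gp_sub B : gp B -> A B.
Proof. by case=> C /= /stone_sub aC <-; exact: galgebra_translate. Qed.

Let gp_proper : ~ gp set0.
Proof. by rewrite gpE /ltranslate image_set0; exact: stone_proper. Qed.

Let gpI B C : gp B -> gp C -> gp (B `&` C).
Proof.
rewrite !gpE => pB pC; suff -> : ltranslate g^-1 (B `&` C) =
  ltranslate g^-1 B `&` ltranslate g^-1 C by exact: stoneI.
by apply/seteqP; split=> x; rewrite /setI /= !ltranslateE.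
Qed.

Let gp_up B C : gp B -> A C -> B `<=` C -> gp C.
Proof.
rewrite !gpE => pB aC BC; apply: stone_up pB (galgebra_translate _ aC) _.
by move=> _ [b Bb <-]; exists b => //; exact: BC.
Qed.

Let gp_ultra B : A B -> gp B \/ gp (~` B).
Proof.
move=> aB; rewrite !gpE; suff -> : ltranslate g^-1 (~` B) =
  ~` ltranslate g^-1 B by exact/stone_ultra/galgebra_translate.
by apply/seteqP; split=> x; rewrite /setC /= !ltranslateE.
Qed.

Definition stone_act : stone A := Stone gp_sub gp_proper gpI gp_up gp_ultra.

End ActionDef.

Section Principal.
Let pe : set G -> Prop := [set B | A B /\ B 1].

Let pe_sub B : pe B -> A B. Proof. by case. Qed.

Let pe_proper : ~ pe set0. Proof. by case. Qed.

Let peI B C : pe B -> pe C -> pe (B `&` C).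
Proof. by move=> [aB B1] [aC C1]; split=> //; exact: galgebraI. Qed.

Let pe_up B C : pe B -> A C -> B `<=` C -> pe C.
Proof. by move=> [_ B1] aC BC; split=> //; exact: BC. Qed.

Let pe_ultra B : A B -> pe B \/ pe (~` B).
Proof.
move=> aB; have [B1|nB1] := pselect (B 1); first by left.
by right; split=> //; exact: galgebraC.
Qed.

Definition stone_pt : stone A := Stone pe_sub pe_proper peI pe_up pe_ultra.

End Principal.

Definition dset (p : stone A) (B : set G) : set G :=
  [set g | p (ltranslate g^-1 B)].

Definition d_closed := forall (p : stone A) B, A B -> A (dset p B).

End Action.
End StoneSpace.

Arguments galgebra : clear implicits.
Arguments stone_act {G} A g p.

(* Main.v *)
Require Import Defs.
From HB Require Import structures.
From mathcomp Require Import all_boot.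
From mathcomp Require Import boolp classical_sets functions cardinality topology.

(** Everything rests on the sets of return times [{g | g x \in U}] of points
    [x] to clopen sets [U]. A coloring [c] is definable exactly when
    [c(g)(i)] tells whether [g^-1] is a return time of [y_i] to [U_i], and a
    semigroup operation extending the action turns return times of any point
    [x] into return times of [x0]: since [g x = (g x0) * x], the return times
    of [x] to [U] are those of [x0] to the preimage of [U] under right
    translation by [x], which is again clopen by left-continuity
    ([return_times_op]). Hence every [X]-definable coloring is already
    [{x0}]-definable, and the three Ramsey properties concern the same colorings
    ([definable_op]).

    The same observation gives the equivalence with d-closed algebras. The
    return times of [x0] to clopen sets form a [G]-algebra; sending [x] to the
    ultrafilter of those [{g | g x0 \in U}] with [x \in U] is an isomorphism of
    the ambit onto its Stone space ([stone_of_isomorphic]): it is well defined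
    because the orbit of [x0] is dense, bijective because [X] is compact,
    Hausdorff and has a clopen basis. Under this identification the set
    [d_p(A)] for the ultrafilter [p] of [x] and the return times [A] of [x0] to
    [U] is the set of return times of [x] to [U], so d-closedness is the
    observation above. Conversely, if the algebra is d-closed, every [d_p] is
    a Boolean endomorphism of it that commutes with translations, so
    [p * q = {B | d_q(B) \in p}] is an operation on its Stone space; it is
    associative because [d_(p * q) = d_p \o d_q], and it is carried over to [X]
    along the isomorphism ([semigroup_ext_isomorphic]). *)

Set Implicit Arguments.
Unset Strict Implicit.
Unset Printing Implicit Defensive.

Local Open Scope classical_set_scope.
Local Open Scope group_scope.

(** * Return times and Ramsey properties *)

Section ReturnTimes.
Context {G : topologicalGroupType} {X : topologicalType}.
Variables (act : G -> X -> X) (x0 : X).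
Implicit Types (x : X) (U : set X) (g : G).

Definition return_times x U : set G := [set g | U (act g x)].

Lemma flow_act_continuous g : is_flow act -> continuous (act g).
Proof.
case=> _ _ _ act_cont x.
apply: (continuous_comp (f := pair g) (g := fun gx => act gx.1 gx.2)).
  by apply: cvg_pair => //; exact: cvg_cst.
exact: act_cont.
Qed.

Lemma image_actE g U y : is_action act -> (act g @` U) y <-> U (act g^-1 y).
Proof.
case=> act1 actM; split; first by case=> x Ux <-; rewrite -actM mulVg act1.
by move=> Uy; exists (act g^-1 y) => //; rewrite -actM mulgV act1.
Qed.

Lemma return_times_op op x U : left_continuous_semigroup_ext act x0 op ->
  return_times x U = return_times x0 (op^~ x @^-1` U).
Proof.
by case=> _ _ opE; apply/funext => g; rewrite /return_times /preimage /= opE.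
Qed.

(** The points defining a coloring can be moved to [x0] at the expense of
    changing the clopen sets. *)
Lemma definable_op op (S : set X) n (c : G -> {ffun 'I_n -> bool}) :
  is_action act -> left_continuous_semigroup_ext act x0 op ->
  definable act S c -> definable act [set x0] c.
Proof.
move=> actA lcs [U [y [Uy cE]]].
exists (fun i => op^~ (y i) @^-1` U i), (fun=> x0); split=> [i | g i].
  by split=> //; case: lcs => _ op_cont _; apply: preimage_clopen; case: (Uy i).
rewrite cE !image_actE //.
by rewrite -[U i _]/(return_times (y i) (U i) g^-1) (return_times_op _ _ lcs).
Qed.

Lemma has_DRP_forS (S T : set X) :
  S `<=` T -> has_DRP_for act T -> has_DRP_for act S.
Proof.
move=> ST drpT n c n_gt0 [U [y [Uy cE]]]; apply: drpT => //.
by exists U, y; split=> // i; have [cU Sy] := Uy i; split=> //; exact: ST.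
Qed.

Lemma WDRP_EDRP op : is_action act -> left_continuous_semigroup_ext act x0 op ->
  WDRP act x0 -> EDRP act.
Proof.
by move=> actA lcs wdrp n c n_gt0 /(definable_op actA lcs) /wdrp; exact.
Qed.

End ReturnTimes.

(** * Transport along isomorphisms of ambits *)

Section Transport.
Context {G : topologicalGroupType} {X Y : topologicalType}.
Variables (actX : G -> X -> X) (x0 : X) (actY : G -> Y -> Y) (y0 : Y).
Hypothesis iso : ambit_isomorphic actX x0 actY y0.

Lemma is_ambit_isomorphic : is_ambit actX x0 -> is_ambit actY y0.
Proof.
case: iso => f [f' [[fK f'K] f_cont f'_cont fact fx0]].
case=> [[cX hX [act1 actM] act_cont] dX].
have factV g y : f' (actY g y) = actX g (f' y).
  by rewrite -{1}[y]f'K -fact fK.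
split; first split.
- have -> : [set: Y] = f @` [set: X].
    by apply/seteqP; split=> // y _; exists (f' y).
  by apply: continuous_compact => //; exact: continuous_subspaceT.
- move: hX; rewrite !open_hausdorff => hX x y xy.
  have fxy : f' x != f' y by apply: contra_neq xy => /(can_inj f'K).
  have [[A B] /= [/set_mem xA /set_mem yB] [oA oB AB]] := hX _ _ fxy.
  exists (f' @^-1` A, f' @^-1` B) => /=; first by split; apply/mem_set.
  split; [exact: (continuousP f').1 | exact: (continuousP f').1 |].
  by rewrite -preimage_setI (eqP AB) preimage_set0.
- by split=> [y | g h y]; apply: (can_inj f'K); rewrite !factV ?act1 ?actM.
- have -> : (fun gy : G * Y => actY gy.1 gy.2) =
      f \o (fun gx : G * X => actX gx.1 gx.2) \o (fun gy => (gy.1, f' gy.2)).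
    by apply/funext => -[g y] /=; rewrite fact f'K.
  move=> [g y]; apply: continuous_comp; last first.
    by apply: continuous_comp; [exact: act_cont | exact: f_cont].
  apply: cvg_pair; first exact: cvg_fst.
  by apply: (cvg_comp snd f'); [exact: cvg_snd | exact: f'_cont].
- move=> O [y Oy] oO.
  have fO : f @^-1` O !=set0 by exists (f' y); rewrite /preimage /= f'K.
  have [z [/= + [g _ gE]]] := dX _ fO ((continuousP f).1 f_cont _ oO).
  rewrite -gE /preimage /= => Og.
  by exists (actY g y0); split; [rewrite -fx0 -fact | exists g].
Qed.

Lemma semigroup_ext_isomorphic :
  (exists op, left_continuous_semigroup_ext actY y0 op) ->
  exists op, left_continuous_semigroup_ext actX x0 op.
Proof.
case: iso => f [f' [[fK f'K] f_cont f'_cont fact fx0]].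
case=> op [opA op_cont opE]; exists (fun x y => f' (op (f x) (f y))); split.
- by move=> x y z; rewrite !f'K opA.
- move=> y x; apply: (continuous_comp (f := op^~ (f y) \o f)).
    by apply: continuous_comp; [exact: f_cont | exact: op_cont].
  exact: f'_cont.
- by move=> g x; rewrite fact fx0 opE -fact fK.
Qed.

End Transport.

(** * The semigroup operation on the Stone space of a d-closed algebra *)

Section Stone.
Context {G : groupType} (A : galgebra G).
Implicit Types (p q r : stone A) (B C : set G) (g : G).

Lemma stone_ext p q : (forall B, p B <-> q B) -> p = q.
Proof.
case: p q => [p ? ? ? ? ?] [q ? ? ? ? ?] /= pq.
have {}pq : p = q by apply/funext => B; apply/propext.
by subst q; congr Stone; exact: Prop_irrelevance.
Qed.

Lemma stoneC p B : A B -> p (~` B) <-> ~ p B.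
Proof.
move=> aB; split=> [pnB pB | npB]; last by case: (stone_ultra p aB).
by apply: (@stone_proper _ _ p); rewrite -(setICr B); exact: stoneI.
Qed.

Lemma stone_open B : A B -> open [set p : stone A | p B].
Proof.
move=> aB; exists [set B]; last by rewrite bigcup_set1.
by move=> C /= ->.
Qed.

(** Every open set is a union of basic ones, so these suffice to test
    continuity. *)
Lemma continuous_to_stone (Y : topologicalType) (f : Y -> stone A) :
  (forall B, A B -> open [set y | f y B]) -> continuous f.
Proof.
move=> f_open; apply/continuousP => _ [D sD <-].
rewrite preimage_bigcup; apply: bigcup_open => B DB; apply: f_open.
exact: sD.
Qed.

Lemma stone_actE g p B : stone_act A g p B <-> p (ltranslate g^-1 B).
Proof.
split; first by case=> C pC <-; rewrite ltranslateK.
by move=> pB; exists (ltranslate g^-1 B) => //; rewrite ltranslateKV.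
Qed.

Lemma ltranslateC g B : ltranslate g (~` B) = ~` ltranslate g B.
Proof. by apply/seteqP; split=> x; rewrite /setC /= !ltranslateE. Qed.

Lemma ltranslateI g B C :
  ltranslate g (B `&` C) = ltranslate g B `&` ltranslate g C.
Proof. by apply/seteqP; split=> x; rewrite /setI /= !ltranslateE. Qed.

Lemma ltranslateM g h B : ltranslate (g * h) B = ltranslate g (ltranslate h B).
Proof. by apply/seteqP; split=> x; rewrite !ltranslateE invgM mulgA. Qed.

Lemma dsetE p B g : dset p B g = p (ltranslate g^-1 B).
Proof. by []. Qed.

Lemma dset_ltranslate p g B :
  dset p (ltranslate g B) = ltranslate g (dset p B).
Proof.
apply/seteqP; split=> h; rewrite ltranslateE /dset /=;
  by rewrite invgM invgK ltranslateM.
Qed.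

Lemma dset0 p : dset p set0 = set0.
Proof.
by apply/seteqP; split=> // g; rewrite /dset /ltranslate /= image_set0;
  exact: stone_proper.
Qed.

Lemma dsetC p B : A B -> dset p (~` B) = ~` dset p B.
Proof.
move=> aB; apply/seteqP; split=> g; rewrite /dset /setC /= ltranslateC;
  by rewrite (stoneC p (galgebra_translate _ aB)).
Qed.

Lemma dsetI p B C : A B -> A C -> dset p (B `&` C) = dset p B `&` dset p C.
Proof.
move=> aB aC; apply/seteqP; split=> g; rewrite /dset /setI /= ltranslateI;
  last by case; exact: stoneI.
by move=> pBC; split; apply: stone_up pBC (galgebra_translate _ _) _ => // h [].
Qed.

Lemma dsetS p B C : A B -> A C -> B `<=` C -> dset p B `<=` dset p C.
Proof.
move=> aB aC BC g pB; apply: stone_up pB (galgebra_translate _ aC) _.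
exact: image_subset.
Qed.

Section StoneMul.
Hypothesis dA : d_closed A.

Section StoneMulDef.
Variables p q : stone A.
Let pq : set G -> Prop := [set B | A B /\ p (dset q B)].

Let pq_sub B : pq B -> A B. Proof. by case. Qed.

Let pq_proper : ~ pq set0.
Proof. by case=> _; rewrite dset0; exact: stone_proper. Qed.

Let pqI B C : pq B -> pq C -> pq (B `&` C).
Proof.
move=> [aB pB] [aC pC]; split; first exact: galgebraI.
by rewrite dsetI //; exact: stoneI.
Qed.

Let pq_up B C : pq B -> A C -> B `<=` C -> pq C.
Proof.
move=> [aB pB] aC BC; split=> //.
by apply: stone_up pB (dA _ aC) _; exact: dsetS.
Qed.

Let pq_ultra B : A B -> pq B \/ pq (~` B).
Proof.
move=> aB; have [pB | npB] := stone_ultra p (dA q aB); first by left.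
by right; split; [exact: galgebraC | rewrite dsetC].
Qed.

Definition stone_mul : stone A := Stone pq_sub pq_proper pqI pq_up pq_ultra.

End StoneMulDef.

Lemma dset_mul p q B : A B -> dset (stone_mul p q) B = dset p (dset q B).
Proof.
move=> aB; apply/seteqP; split=> g; rewrite /dset /= dset_ltranslate.
  by case.
by split=> //; exact: galgebra_translate.
Qed.

(** Both sides contain [B] exactly when [p] contains
    [dset q (dset r B)]. *)
Lemma stone_mulA : associative stone_mul.
Proof.
move=> p q r; apply: stone_ext => B /=; split.
  by case=> aB; rewrite dset_mul // => pB; do 2!split=> //; exact: dA.
by case=> aB [_ pB]; rewrite dset_mul.
Qed.

Lemma stone_mul_continuous q : continuous (stone_mul^~ q).
Proof.
apply: continuous_to_stone => B aB.
rewrite (_ : [set _ | _] = [set p : stone A | p (dset q B)]).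
  exact/stone_open/dA.
by apply/seteqP; split=> p /=; [case | split].
Qed.

Lemma stone_mul_act g p : stone_mul (stone_act A g (stone_pt A)) p =
  stone_act A g p.
Proof.
apply: stone_ext => B; rewrite stone_actE; split.
  case=> aB /stone_actE [_] /=.
  by rewrite ltranslateE invgK mulg1.
move=> pB; have aB : A B.
  by rewrite -(ltranslateKV g B); exact/galgebra_translate/(stone_sub pB).
split=> //; apply/stone_actE; split; first exact/galgebra_translate/dA.
by rewrite ltranslateE invgK mulg1.
Qed.

End StoneMul.
End Stone.

Lemma stone_semigroup_ext (G : topologicalGroupType) (A : galgebra G) :
  d_closed A -> exists op,
    left_continuous_semigroup_ext (stone_act A) (stone_pt A) op.
Proof.
move=> dA; exists (stone_mul dA); split.
- exact: stone_mulA.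
- exact: stone_mul_continuous.
- exact: stone_mul_act.
Qed.

(** * The algebra of return times of an ambit *)

Section ReturnAlgebra.
Context {G : topologicalGroupType} {X : topologicalType}.
Variables (act : G -> X -> X) (x0 : X).
Hypothesis ambX : is_ambit act x0.
Implicit Types (x : X) (U V : set X) (g : G) (B C : set G).

Let flowX : is_flow act. Proof. by case: ambX. Qed.
Let actX : is_action act. Proof. by case: flowX. Qed.

Let act_clopen g U : clopen U -> clopen (act g @^-1` U).
Proof.
by move=> cU; apply: preimage_clopen => //; exact: flow_act_continuous.
Qed.

Lemma ltranslate_return_times g x U :
  ltranslate g (return_times act x U) = return_times act x (act g^-1 @^-1` U).
Proof.
by apply/seteqP; split=> h; rewrite ltranslateE /return_times /preimage /=
  (proj2 actX).
Qed.

Let alg : set G -> Prop := [set return_times act x0 U | U in clopen].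

Let alg0 : alg set0.
Proof. by exists set0 => //; exact: clopen0. Qed.

Let algC B : alg B -> alg (~` B).
Proof. by case=> U cU <-; exists (~` U) => //; exact: (clopenC U). Qed.

Let algU B C : alg B -> alg C -> alg (B `|` C).
Proof.
by move=> [U cU <-] [V cV <-]; exists (U `|` V) => //; exact: clopenU.
Qed.

Let algM g B : alg B -> alg (ltranslate g B).
Proof.
case=> U cU <-; exists (act g^-1 @^-1` U); first exact: act_clopen.
by rewrite ltranslate_return_times.
Qed.

Definition return_algebra : galgebra G := GAlgebra alg0 algC algU algM.

(** If [U] were not contained in [V], the dense orbit would meet the open set
    [U `\` V]. Consequently a clopen set is determined by its return times,
    which makes [stone_of] below well defined. *)
Lemma return_times_sub U V : clopen U -> clopen V ->
  return_times act x0 U `<=` return_times act x0 V -> U `<=` V.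
Proof.
move=> [oU _] [_ cV] UV x Ux; apply: contrapT => nVx.
have UV0 : U `&` ~` V !=set0 by exists x.
have [z [[Ug nVg] [g _ gE]]] := proj2 ambX _ UV0 (openI oU (closed_openC cV)).
by apply: nVg; rewrite -gE; apply: UV; rewrite /return_times /= gE.
Qed.

Section StoneOf.
Variable x : X.
Let px : set G -> Prop :=
  [set return_times act x0 U | U in [set U | clopen U /\ U x]].

Let px_sub B : px B -> return_algebra B.
Proof. by case=> U [cU _] <-; exists U. Qed.

Let px_proper : ~ px set0.
Proof.
case=> U [cU Ux] U0; suff: set0 x by [].
by apply: (return_times_sub cU clopen0) Ux; rewrite U0.
Qed.

Let pxI B C : px B -> px C -> px (B `&` C).
Proof.
move=> [U [cU Ux] <-] [V [cV Vx] <-].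
by exists (U `&` V) => //; split=> //; exact: clopenI.
Qed.

Let px_up B C : px B -> return_algebra C -> B `<=` C -> px C.
Proof.
move=> [U [cU Ux] <-] [V cV <-] UV; exists V => //; split=> //.
exact: (return_times_sub cU cV).
Qed.

Let px_ultra B : return_algebra B -> px B \/ px (~` B).
Proof.
case=> U cU <-; have [Ux | nUx] := pselect (U x); first by left; exists U.
by right; exists (~` U) => //; split=> //; exact: (clopenC U).
Qed.

Definition stone_of : stone return_algebra :=
  Stone px_sub px_proper pxI px_up px_ultra.

End StoneOf.

Lemma stone_ofE x U :
  clopen U -> stone_of x (return_times act x0 U) <-> U x.
Proof.
move=> cU; split=> [[V [cV Vx] VU] | Ux]; last by exists U.
by apply: (return_times_sub cV cU) Vx; rewrite VU.
Qed.

Lemma stone_of_pt : stone_of x0 = stone_pt return_algebra.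
Proof.
apply: stone_ext => B; split.
  case=> U [cU Ux] <-; split; first by exists U.
  by rewrite /return_times /= (proj1 actX).
case=> -[U cU <-]; rewrite /return_times /= (proj1 actX) => Ux.
by exists U.
Qed.

Lemma stone_of_act g x :
  stone_of (act g x) = stone_act return_algebra g (stone_of x).
Proof.
have E U : clopen U -> stone_of (act g x) (return_times act x0 U) <->
    stone_act return_algebra g (stone_of x) (return_times act x0 U).
  move=> cU; rewrite stone_actE ltranslate_return_times invgK !stone_ofE //.
  exact: act_clopen.
apply: stone_ext => B; split=> pB; have [U cU BE] := stone_sub pB;
  by move: pB; rewrite -BE E.
Qed.

(** The dynamical meaning of [dset]: [g] belongs to the left-hand side when [x]
    lies in [g^-1 U]. Closure under [dset] is thus a statement about the return
    times of points other than [x0]. *)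
Lemma dset_stone_of x U : clopen U ->
  dset (stone_of x) (return_times act x0 U) = return_times act x U.
Proof.
move=> cU; apply/seteqP; split=> g;
  rewrite dsetE ltranslate_return_times invgK stone_ofE //; exact: act_clopen.
Qed.

(** Compactness: the clopen sets whose return times belong to an ultrafilter
    have a common point. *)
Lemma stone_of_surj (p : stone return_algebra) : exists x, stone_of x = p.
Proof.
pose F : set_system X :=
  filter_from [set U | clopen U /\ p (return_times act x0 U)] id.
have PF : ProperFilter F.
  apply: filter_from_proper => [|U [_ pU]].
    apply: filter_from_filter.
      by exists setT; split; [exact: clopenT | exact: stoneT].
    move=> U V [cU pU] [cV pV]; exists (U `&` V) => //.
    by split; [exact: clopenI | exact: stoneI].
  apply/set0P/eqP => U0; apply: (@stone_proper _ _ p).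
  by move: pU; rewrite U0.
have [cX _ _ _] := flowX.
have [x [_ xF]] := cX F PF filterT.
have pU U : clopen U -> p (return_times act x0 U) -> U x.
  move=> cU pU; have [_ clU] := cU; apply: clU.
  by move: xF; rewrite clusterE; apply; exists U.
exists x; apply: stone_ext => B; split=> pB; have [U cU BE] := stone_sub pB;
  move: pB; rewrite -{}BE stone_ofE //; last exact: pU.
move=> Ux; apply: contrapT => npU.
apply: (pU (~` U)) Ux; first exact: (clopenC U).
by apply/(stoneC p) => //; exists U.
Qed.

Section ClopenBased.
Hypothesis clX : clopen_based X.

Lemma stone_of_inj : injective stone_of.
Proof.
move=> x y xy; apply: contrapT => /eqP nxy.
have [_ hX _ _] := flowX; move: hX; rewrite open_hausdorff => /(_ x y nxy).
case=> -[U V] /= [/set_mem Ux /set_mem Vy] [oU _ /eqP UV].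
have [B [[_ Bbase] Bcl]] := clX.
have [W [BW Wx] WU] := Bbase x U (open_nbhs_nbhs (conj oU Ux)).
have cW : clopen W by exact: Bcl.
have Wy : W y by apply/(stone_ofE y cW); rewrite -xy; apply/stone_ofE.
by suff: set0 y by []; rewrite -UV; split=> //; exact: WU.
Qed.

Lemma stone_of_isomorphic :
  ambit_isomorphic act x0 (stone_act return_algebra) (stone_pt return_algebra).
Proof.
have [f' f'K] := choice stone_of_surj.
exists stone_of, f'; split.
- by split=> // x; apply: stone_of_inj; rewrite f'K.
- apply: continuous_to_stone => _ [U cU <-].
  rewrite (_ : [set _ | _] = U); first by case: cU.
  by apply/seteqP; split=> x; rewrite -(stone_ofE x cU).
(* The inverse is continuous since the preimage under it of a clopen set is the
   basic open set given by its return times. *)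
- move=> p; have [B [[_ Bbase] Bcl]] := clX.
  move=> V /Bbase [W [BW Wp] WV]; have cW : clopen W by exact: Bcl.
  have pE (q : stone return_algebra) : q (return_times act x0 W) <-> W (f' q).
    by rewrite -{1}(f'K q) stone_ofE.
  apply: (@filterS _ _ _ [set q : stone return_algebra
    | q (return_times act x0 W)]).
    by move=> q /pE; exact: WV.
  apply: open_nbhs_nbhs; split; last exact/pE.
  by apply: stone_open; exists W.
- exact: stone_of_act.
- exact: stone_of_pt.
Qed.

End ClopenBased.

(** Every ultrafilter comes from a point [x], and the return times of [x] to [U]
    are those of [x0] to the preimage of [U] under right translation by [x]. *)
Lemma return_algebra_d_closed op :
  left_continuous_semigroup_ext act x0 op -> d_closed return_algebra.
Proof.
move=> lcs p _ [U cU <-]; have [x <-] := stone_of_surj p.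
rewrite dset_stone_of // (return_times_op _ _ lcs).
exists (op^~ x @^-1` U) => //; apply: preimage_clopen => //.
by case: lcs.
Qed.

End ReturnAlgebra.

(** * The equivalences *)

Theorem corollary3p9 (G : topologicalGroupType) (X : topologicalType)
    (act : G -> X -> X) (x0 : X) :
  is_ambit act x0 -> clopen_based X ->
  ((exists op : X -> X -> X, left_continuous_semigroup_ext act x0 op) <->
   (exists A : galgebra G,
      [/\ d_closed A, is_ambit (stone_act A) (stone_pt A)
        & ambit_isomorphic act x0 (stone_act A) (stone_pt A)])) /\
  ((exists op : X -> X -> X, left_continuous_semigroup_ext act x0 op) ->
   (EDRP act <-> DRP act x0) /\ (DRP act x0 <-> WDRP act x0)).
Proof.
move=> ambX clX; split; first split.
- case=> op lcs; exists (return_algebra ambX).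
  have iso := stone_of_isomorphic ambX clX.
  split=> //; first exact: return_algebra_d_closed lcs.
  exact: is_ambit_isomorphic iso ambX.
- case=> A [dA _ iso]; apply: semigroup_ext_isomorphic iso _.
  exact: stone_semigroup_ext.
case=> op lcs; have [[_ _ actA _] _] := ambX.
have ED : EDRP act -> DRP act x0 by exact: has_DRP_forS.
have DW : DRP act x0 -> WDRP act x0.
  by apply: has_DRP_forS => _ ->; exists 1; case: actA.
have WE : WDRP act x0 -> EDRP act by exact: WDRP_EDRP lcs.
by split; split=> // ?; [exact/WE/DW | exact/ED/WE].
Qed.
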